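(* Let $R=\mathbb{K}[x_{i,i+1},x_{i,i+2}: i\in\mathbb{N}]$ and $I=\ker\varphi$, where $\varphi: R\to\mathbb{K}[x_i: i\in\mathbb{N}]$ is the $\mathbb{K}$-algebra homomorphism with $\varphi(x_{i,i+1})=x_ix_{i+1}$ and $\varphi(x_{i,i+2})=x_ix_{i+2}$. Then the set $\mathcal{G}=\{g_2\}\cup\{g^{\mathbf{s}}: \mathbf{s}\in\{1,2\}^n, n\in\mathbb{N}_0\}$ generates $I$ minimally up to shift: the shifts $\operatorname{sh}_k(g)$, $g\in\mathcal{G}$, $k\in\mathbb{N}_0$, generate $I$ as an ideal, and for no proper subset of $\mathcal{G}$ do the shifts of its elements generate $I$.
   Context: $\mathbb{K}$ is a field. The shift $\operatorname{sh}_k$ ($k\in\mathbb{N}_0$) is the ring endomorphism of $R$ with $x_{i,j}\mapsto x_{i+k,j+k}$. Let $E=\{[i,i+1],[i,i+2]: i\in\mathbb{N}\}$ (index pairs of the variables), totally ordered by $[i,j]\le[k,l]$ iff $i\le k$ and $j\le l$. For a binomial $g=\prod x_{i,j}^{u_{i,j}}-\prod x_{i,j}^{v_{i,j}}$ set $w_g([i,j])=u_{i,j}-v_{i,j}$; conversely, for a finitely supported $w:E\to\mathbb{Z}$ the associated binomial is $\prod_{[i,j]\in E}x_{i,j}^{\max(w([i,j]),0)}-\prod_{[i,j]\in E}x_{i,j}^{\max(-w([i,j]),0)}$. A vertex $n\in\mathbb{N}$ is adjacent to $g$ if $n\in\{i,j\}$ for some $[i,j]$ with $w_g([i,j])\ne0$.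 Set $g_2=x_{1,2}x_{3,4}-x_{1,3}x_{2,4}$ and $g^{\emptyset}=x_{1,2}x_{3,5}^2x_{6,7}-x_{1,3}x_{2,3}x_{5,6}x_{5,7}$. For a finite sequence $\mathbf{s}=(s_1,\dots,s_n)\in\{1,2\}^n$ write $\mathbf{s}1=(s_1,\dots,s_n,1)$, $\mathbf{s}2=(s_1,\dots,s_n,2)$. Recursively, if $g^{\mathbf{s}}$ is defined with $w=w_{g^{\mathbf{s}}}$ and $k$ is the largest vertex adjacent to $g^{\mathbf{s}}$, then $g^{\mathbf{s}1}$ and $g^{\mathbf{s}2}$ are the binomials associated to the weight functions $w_{g^{\mathbf{s}1}}([i,j])=w([i,j])$ if $[i,j]\le[k-4,k-2]$; $=2w([i,j])$ if $[i,j]=[k-2,k]$; $=-w([i-2,j-2])$ if $[i,j]\ge[k,k+1]$; $=0$ otherwise; $w_{g^{\mathbf{s}2}}([i,j])=w([i,j])$ if $[i,j]\le[k-4,k-2]$; $=2w([i,j])$ if $[i,j]=[k-2,k-1]$; $=-2w([k-2,k-1])$ if $[i,j]=[k-1,k+1]$; $=w([i-3,j-3])$ if $[i,j]\ge[k+1,k+2]$; $=0$ otherwise. *)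

(* Defs.v *)
From HB Require Import structures.
From mathcomp Require Import all_boot all_order all_algebra.
From mathcomp Require Import finmap.
From mathcomp.multinomials Require Import monalg.

Set Implicit Arguments.
Unset Strict Implicit.
Unset Printing Implicit Defensive.

Import GRing.Theory Num.Theory.
Local Open Scope ring_scope.

Definition Epred (p : nat * nat) : bool :=
  (0 < p.1)%N && ((p.2 == p.1.+1) || (p.2 == p.1.+2)).
Definition E := {p : nat * nat | Epred p}.

Notation RR K := (@malg (cmonom E) K).
Notation SS K := (@malg (cmonom nat) K).

(* the variable x_{i,j} of R (0 if [i,j] is not in E; never used that way) *)
Definition xv (K : fieldType) (i j : nat) : RR K :=
  if @insub _ Epred E (i, j) is Some e then << ucm e >> else 0.

Definition yv (K : fieldType) (i : nat) : SS K := << ucm i >>.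

Definition evalm (I : choiceType) (S : nzRingType) (h : I -> S) (m : cmonom I) : S :=
  \prod_(i <- finsupp (cmonom_val m)) h i ^+ (cmonom_val m i).

Definition phi (K : fieldType) (f : RR K) : SS K :=
  mmap (fun c : K => c%:MP) (evalm (fun e : E => yv K (val e).1 * yv K (val e).2)) f.

Definition sh (K : fieldType) (k : nat) (f : RR K) : RR K :=
  mmap (fun c : K => c%:MP)
       (evalm (fun e : E => xv K ((val e).1 + k) ((val e).2 + k))) f.

Definition ideal_gen (K : fieldType) (P : RR K -> Prop) (f : RR K) : Prop :=
  exists l : seq (RR K * RR K),
    (forall p, p \in l -> P p.2) /\ f = \sum_(p <- l) p.1 * p.2.

Definition shifts (K : fieldType) (P : RR K -> Prop) (f : RR K) : Prop :=
  exists g k, P g /\ f = sh k g.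

Definition g2 (K : fieldType) : RR K :=
  xv K 1 2 * xv K 3 4 - xv K 1 3 * xv K 2 4.

(* weight functions: w i j = w([i,j]), together with a bound N such that
   w([i,j]) = 0 for every [i,j] in E with i >= N *)
Definition pospart (z : int) : nat := if z is Posz n then n else 0%N.
Definition negpart (z : int) : nat := pospart (- z).

Definition binom_of (K : fieldType) (w : nat -> nat -> int) (N : nat) : RR K :=
  \prod_(1 <= i < N) (xv K i i.+1 ^+ pospart (w i i.+1) * xv K i i.+2 ^+ pospart (w i i.+2))
  - \prod_(1 <= i < N) (xv K i i.+1 ^+ negpart (w i i.+1) * xv K i i.+2 ^+ negpart (w i i.+2)).

(* weight of g^emptyset = x12 x35^2 x67 - x13 x23 x56 x57 *)
Definition w0 (i j : nat) : int :=
  match i, j with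
  | 1, 2 => 1 | 3, 5 => 2 | 6, 7 => 1
  | 1, 3 => -1 | 2, 3 => -1 | 5, 6 => -1 | 5, 7 => -1
  | _, _ => 0
  end.

Definition lvert (w : nat -> nat -> int) (N : nat) : nat :=
  (\max_(1 <= i < N) maxn (if w i i.+1 != 0 then i.+1 else 0)
                          (if w i i.+2 != 0 then i.+2 else 0))%N.

Definition leE (i j k l : nat) : bool := (i <= k)%N && (j <= l)%N.

Definition step1 (w : nat -> nat -> int) (N : nat) : nat -> nat -> int :=
  let k := lvert w N in
  fun i j =>
    if leE i j (k - 4)%N (k - 2)%N then w i j
    else if (i == (k - 2)%N) && (j == k) then 2 * w i j
    else if leE k k.+1 i j then - w (i - 2)%N (j - 2)%N
    else 0.

Definition step2 (w : nat -> nat -> int) (N : nat) : nat -> nat -> int :=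
  let k := lvert w N in
  fun i j =>
    if leE i j (k - 4)%N (k - 2)%N then w i j
    else if (i == (k - 2)%N) && (j == (k - 1)%N) then 2 * w i j
    else if (i == (k - 1)%N) && (j == k.+1) then - (2 * w (k - 2)%N (k - 1)%N)
    else if leE k.+1 k.+2 i j then w (i - 3)%N (j - 3)%N
    else 0.

(* one recursion step: digit 1 uses rule s1, digit 2 rule s2; the support
   bound grows by at most 3 *)
Definition wstep (wN : (nat -> nat -> int) * nat) (d : nat) :=
  (if d == 1%N then step1 wN.1 wN.2 else step2 wN.1 wN.2, (wN.2 + 3)%N).

Definition gs (K : fieldType) (s : seq nat) : RR K :=
  let wN := foldl wstep (w0, 7%N) s in binom_of K wN.1 wN.2.

Definition Gset (K : fieldType) (g : RR K) : Prop :=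
  g = g2 K \/
  exists s : seq nat, all (fun d => (d == 1%N) || (d == 2%N)) s /\ g = gs K s.

Definition inI (K : fieldType) (f : RR K) : Prop := phi f = 0.

(* Main.v *)
(* A binomial [u - v] lies in [I] when the multigraphs [u] and [v] have the same
   vertex degrees, and these binomials span [I]. To generate [I], suppose that
   [u] and [v] have equal degrees and that no monomials congruent to them share
   an edge; let b be the least vertex. Exchanges by shifts of [g2] show that, up
   to swapping, [u] contains [b, b+1] and [b+2, b+4]^2 while [v] contains
   [b, b+2][b+1, b+2]. This is the start of some [g^s] whose second triangle is
   still open at [b+4]. Closing it would allow a move creating a common edge, so
   degree counting forces the path of double edges to go on, by one of the two
   recursion rules, and it never ends: a contradiction.

   For minimality, the graph of [g^s] is an induced subgraph of the square of
   the infinite path and consists of two triangles joined by a path. Hence a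
   monomial with the degrees of [g^s] is determined, from left to right, by the
   exponent 0 or 1 of [x12]. So the fibre contains only the two monomials of
   [g^s], and no combination of shifts of other generators produces [g^s]. *)
Require Import Defs.
From HB Require Import structures.
From mathcomp Require Import all_boot all_order all_algebra.
From mathcomp Require Import finmap.
From mathcomp.multinomials Require Import monalg.
From mathcomp Require Import zify.
From Stdlib Require Import Classical.

Set Implicit Arguments.
Unset Strict Implicit.
Unset Printing Implicit Defensive.

Import GRing.Theory Num.Theory.
Local Open Scope ring_scope.

(** * Monomials as multisets of edges *)

Section MonomialSubstitution.
Context (I J : choiceType).
Implicit Types (h : I -> cmonom J) (m : cmonom I).

Lemma expcmnE (T : choiceType) (m : cmonom T) n i : expcmn m n i = (n * m i)%N.
Proof.
elim: n => [|[|n] IHn]; first by rewrite cm1.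
  by rewrite mul1n.
by rewrite [LHS](mulcmE m (expcmn m n.+1)) IHn mulSn.
Qed.

(** Exponent form of an algebra map that sends every variable to a monomial; [phi] and [sh k] both
    act on monomials in this way. *)
Definition msubst h m : cmonom J :=
  \big[mmul/mone]_(i <- finsupp m) expcmn (h i) (m i).

Lemma msubstE h m j : msubst h m j = (\sum_(i <- finsupp m) m i * h i j)%N.
Proof.
rewrite /msubst (big_morph (fun x : cmonom J => x j) (cmM j) (cm1 j)).
by apply: eq_bigr => i _; rewrite expcmnE.
Qed.

End MonomialSubstitution.

(* Locked, lest the failed comparison of two distinct monomials unfold the
   finitely supported functions behind them. *)
HB.lock Definition mterm (K : fieldType) (T : choiceType) (c : K) (m : cmonom T) :
  @malg (cmonom T) K := << c *g m >>.

Section MonomialsInAlgebra.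
Context (K : fieldType) (T : choiceType).
Implicit Types (m : cmonom T) (c : K).

Local Notation mterm := (@mterm K T).

Definition mon m : @malg (cmonom T) K := mterm 1 m.

Lemma mtermE c m : mterm c m = << c *g m >>.
Proof. by rewrite mterm.unlock. Qed.

Lemma mon1 : mon mone = 1.
Proof. exact: mtermE. Qed.

Lemma mtermM c1 c2 m1 m2 :
  mterm c1 m1 * mterm c2 m2 = mterm (c1 * c2) (mmul m1 m2).
Proof. by rewrite !mtermE; apply: fgmulUU. Qed.

Lemma mterm_mon c m1 m2 : mterm c m1 * mon m2 = mterm c (mmul m1 m2).
Proof. by rewrite mtermM mulr1. Qed.

Lemma monM m1 m2 : mon m1 * mon m2 = mon (mmul m1 m2).
Proof. exact: mterm_mon. Qed.

Lemma monX m n : mon m ^+ n = mon (expcmn m n).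
Proof.
elim: n => [|n IHn]; first by rewrite expr0 mon1.
rewrite exprS IHn monM; congr mon.
by apply/eqP/cmP => i; rewrite cmM !expcmnE mulSn.
Qed.

Lemma mon_prod (A : Type) (r : seq A) (F : A -> cmonom T) :
  \prod_(i <- r) mon (F i) = mon (\big[mmul/mone]_(i <- r) F i).
Proof. by symmetry; apply: (big_morph mon) => [x y|]; rewrite ?mon1 ?monM. Qed.

Lemma malg_mterm (p : @malg (cmonom T) K) :
  p = \sum_(m <- msupp p) mterm (p@_m) m.
Proof. by rewrite {1}[p]monalgE; apply: eq_bigr => m _; rewrite mtermE. Qed.

Lemma mcoeff_mterm c m m' : (mterm c m)@_m' = c *+ (m == m').
Proof. by rewrite mtermE; apply: mcoeffU. Qed.

Lemma evalm_mon (I : choiceType) (h : I -> cmonom T) (m : cmonom I) :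
  evalm (fun i => mon (h i)) m = mon (msubst h m).
Proof. by rewrite /evalm -mon_prod; apply: eq_bigr => i _; rewrite monX. Qed.

Lemma eq_evalm (I : choiceType) (S : nzRingType) (g h : I -> S) (m : cmonom I) :
  g =1 h -> evalm g m = evalm h m.
Proof. by move=> gh; apply: eq_bigr => i _; rewrite gh. Qed.

End MonomialsInAlgebra.

Section EdgeMultiplicities.
Implicit Types (m : cmonom E).

(** The value 0 outside [E] makes exponents total functions of the indices, so identities between
    multigraphs become linear arithmetic. *)
Definition emult m (p : nat * nat) : nat :=
  if @insub _ Epred E p is Some e then m e else 0%N.

Definition short m i := emult m (i, i.+1).
Definition long m i := emult m (i, i.+2).

Lemma emultE m (e : E) : emult m (val e) = m e.
Proof. by rewrite /emult valK. Qed.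

Lemma emult_out m p : ~~ Epred p -> emult m p = 0%N.
Proof. by move=> np; rewrite /emult insubN. Qed.

Lemma short0 m : short m 0 = 0%N.
Proof. exact: emult_out. Qed.

Lemma long0 m : long m 0 = 0%N.
Proof. exact: emult_out. Qed.

Lemma emultM m1 m2 p : emult (mmul m1 m2) p = (emult m1 p + emult m2 p)%N.
Proof. by rewrite /emult; case: insub => // e; rewrite cmM. Qed.

Lemma shortM m1 m2 i : short (mmul m1 m2) i = (short m1 i + short m2 i)%N.
Proof. exact: emultM. Qed.

Lemma longM m1 m2 i : long (mmul m1 m2) i = (long m1 i + long m2 i)%N.
Proof. exact: emultM. Qed.

Lemma emult_short_long (P : nat -> nat -> Prop) m1 m2 : P 0%N 0%N ->
  (forall i, P (short m1 i) (short m2 i)) ->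
  (forall i, P (long m1 i) (long m2 i)) ->
  forall p, P (emult m1 p) (emult m2 p).
Proof.
move=> P0 Ps Pl [i j]; case: (boolP (Epred (i, j))) => [|nE].
  by rewrite /Epred /= => /andP[_ /orP[]/eqP->]; [apply: Ps|apply: Pl].
by rewrite !emult_out.
Qed.

Lemma cmonomE_ext m1 m2 : short m1 =1 short m2 -> long m1 =1 long m2 -> m1 = m2.
Proof.
move=> es el; apply/eqP/cmP => e; rewrite -!emultE.
exact: (@emult_short_long (fun x y => x = y)).
Qed.

Lemma divmK m a : (forall i, short a i <= short m i)%N ->
  (forall i, long a i <= long m i)%N -> m = mmul a (divcm m a).
Proof.
move=> les lel; apply/eqP/cmP => e; rewrite cmM divcmE subnKC //.
by rewrite -!emultE; apply: (@emult_short_long (fun x y => x <= y)%N).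
Qed.

Lemma emult_sum m p : (\sum_(e <- finsupp m) m e * (val e == p))%N = emult m p.
Proof.
rewrite /emult; case: insubP => [e _ <-|np]; last first.
  by rewrite big1 // => e _; case: eqP np => [<-|]; rewrite ?(valP e) ?muln0.
case: (boolP (e \in finsupp m)) => [em|nem].
  rewrite (big_fsetD1 e) //= eqxx muln1 big1_fset ?addn0 // => f.
  by rewrite in_fsetD1 val_eqE => /andP[/negbTE-> _]; rewrite muln0.
rewrite big_seq big1 => [|f fm]; first by case: mdomP nem.
by rewrite val_eqE; case: eqP fm nem => [->->|]; rewrite ?muln0.
Qed.

(** The exponent of the image under [phi]: the degree sequence of the multigraph [m]. *)
Definition vdeg m : cmonom nat :=
  msubst (fun e : E => mmul (ucm (val e).1) (ucm (val e).2)) m.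

(** Truncated predecessors do no harm: they lead to index 0, which carries no edge. *)
Lemma vdegE m n :
  vdeg m n = (short m n + long m n + short m n.-1 + long m n.-2)%N.
Proof.
rewrite /vdeg msubstE /short /long -!emult_sum -!big_split /=.
apply: eq_bigr => e _; rewrite cmM !ucmE -!mulnDr; congr muln.
case: e => -[i j] /=; rewrite /Epred ?xpair_eqE /=; lia.
Qed.

Lemma vdegM m1 m2 : vdeg (mmul m1 m2) = mmul (vdeg m1) (vdeg m2).
Proof.
by apply/eqP/cmP => n; rewrite cmM !vdegE !shortM !longM; lia.
Qed.

Fact shift_edge_subproof k (e : E) : Epred ((val e).1 + k, (val e).2 + k)%N.
Proof. by have := valP e; rewrite /Epred /=; case: (val e) => i j /=; lia. Qed.

Definition shift_edge k (e : E) : E := Sub _ (shift_edge_subproof k e).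

Definition shm k m : cmonom E := msubst (fun e => ucm (shift_edge k e)) m.

(** For [i <= k] the first index becomes 0, which is outside [E] and gives the required value 0. *)
Lemma emult_shm k m i j : emult (shm k m) (i, j) = emult m (i - k, j - k)%N.
Proof.
case: (boolP (Epred (i, j))) => Eij; last first.
  rewrite !emult_out //; apply: contra Eij; rewrite /Epred /=; lia.
rewrite -[(i, j)](@SubK _ Epred E _ Eij) emultE msubstE -emult_sum.
apply: eq_bigr => e _; rewrite ucmE -val_eqE; congr muln.
case: e => -[x y] /=; move: Eij; rewrite /Epred ?xpair_eqE /= => Eij Exy.
by congr nat_of_bool; apply/idP/idP; lia.
Qed.

Lemma short_shm k m i : short (shm k m) i = short m (i - k).
Proof.
rewrite /short emult_shm; have [ki|ik] := leqP k i; first by rewrite subSn.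
by rewrite !emult_out // /Epred /=; lia.
Qed.

Lemma long_shm k m i : long (shm k m) i = long m (i - k).
Proof.
rewrite /long emult_shm; have [ki|ik] := leqP k i.
  by rewrite !subSn // ltnW // ltnW.
by rewrite !emult_out // /Epred /=; lia.
Qed.

Lemma shm0 m : shm 0 m = m.
Proof. by apply: cmonomE_ext => i; rewrite ?short_shm ?long_shm subn0. Qed.

Lemma vdeg_shm_eq k m1 m2 : vdeg m1 = vdeg m2 -> vdeg (shm k m1) = vdeg (shm k m2).
Proof.
move=> e; apply/eqP/cmP => n; have := congr1 (fun x : cmonom nat => x (n - k)%N) e.
rewrite !vdegE !short_shm !long_shm.
have -> : (n.-1 - k = (n - k).-1)%N by lia.
by have -> : (n.-2 - k = (n - k).-2)%N by lia.
Qed.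

End EdgeMultiplicities.

Definition xm (i j : nat) : cmonom E :=
  if @insub _ Epred E (i, j) is Some e then ucm e else mone.

Lemma xv_monom (K : fieldType) i j : Epred (i, j) -> xv K i j = mon K (xm i j).
Proof. by move=> Eij; rewrite /xv /xm insubT /mon mtermE. Qed.

Lemma emult_xm i j p : Epred (i, j) -> emult (xm i j) p = ((i, j) == p).
Proof.
move=> Eij; rewrite /xm insubT /=; have [Ep|nEp] := boolP (Epred p).
  by rewrite -[p](@SubK _ Epred E _ Ep) emultE ucmE -val_eqE.
by rewrite emult_out //; case: eqP Eij nEp => [->->|].
Qed.

Lemma short_xm_short i j : (0 < i)%N -> short (xm i i.+1) j = (i == j).
Proof.
move=> i0; rewrite /short emult_xm ?xpair_eqE; last by rewrite /Epred /=; lia.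
by congr nat_of_bool; lia.
Qed.

Lemma long_xm_short i j : (0 < i)%N -> long (xm i i.+1) j = 0%N.
Proof.
move=> i0; rewrite /long emult_xm ?xpair_eqE; last by rewrite /Epred /=; lia.
by lia.
Qed.

Lemma short_xm_long i j : (0 < i)%N -> short (xm i i.+2) j = 0%N.
Proof.
move=> i0; rewrite /short emult_xm ?xpair_eqE; last by rewrite /Epred /=; lia.
by lia.
Qed.

Lemma long_xm_long i j : (0 < i)%N -> long (xm i i.+2) j = (i == j).
Proof.
move=> i0; rewrite /long emult_xm ?xpair_eqE; last by rewrite /Epred /=; lia.
by congr nat_of_bool; lia.
Qed.

Definition xm_simpl := (short_xm_short, long_xm_short, short_xm_long, long_xm_long).

Section MapsOnMonomials.
Context (K : fieldType).
Implicit Types (u v m : cmonom E).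

Lemma mmap_mterm (I J : choiceType) (h : cmonom I -> @malg (cmonom J) K)
    (c : K) (m : cmonom I) :
  mmap (fun c : K => c%:MP) h (mterm c m) = mterm c mone * h m.
Proof. by rewrite !mtermE; apply: mmapU. Qed.

Lemma phiB : zmod_morphism (@phi K).
Proof. exact: mmap_is_additive. Qed.

HB.instance Definition _ :=
  GRing.isZmodMorphism.Build (RR K) (SS K) (@phi K) phiB.

Lemma phi_mterm (c : K) m : phi (mterm c m) = mterm c (vdeg m).
Proof.
rewrite /phi mmap_mterm.
rewrite (@eq_evalm _ _ _ (fun e : E => mon K (mmul (ucm (val e).1) (ucm (val e).2)))).
  by rewrite evalm_mon mterm_mon mul1m.
by move=> e; rewrite -monM /yv /mon !mtermE.
Qed.

Lemma sh_mon k m : sh k (mon K m) = mon K (shm k m).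
Proof.
rewrite /sh mmap_mterm (@eq_evalm _ _ _ (fun e => mon K (ucm (shift_edge k e)))).
  by rewrite evalm_mon mterm_mon mul1m.
move=> e; rewrite xv_monom; last exact: shift_edge_subproof.
congr mon; rewrite /xm (insubT Epred (shift_edge_subproof k e)); reflexivity.
Qed.

Lemma shB k : zmod_morphism (@sh K k).
Proof. exact: mmap_is_additive. Qed.

Lemma sh_binomial k u v : sh k (mon K u - mon K v) = mon K (shm k u) - mon K (shm k v).
Proof. by rewrite shB !sh_mon. Qed.

Lemma phi_binomial u v : phi (mon K u - mon K v) = 0 <-> vdeg u = vdeg v.
Proof.
rewrite phiB !phi_mterm; split=> [/eqP|->]; last by rewrite subrr.
rewrite subr_eq0 => /eqP/(congr1 (mcoeff (vdeg u))).
rewrite !mcoeff_mterm eqxx; case: eqP => [->//|_] /eqP.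
by rewrite oner_eq0.
Qed.

Lemma phi_mul_binomial (p : RR K) u v :
  vdeg u = vdeg v -> phi (p * (mon K u - mon K v)) = 0.
Proof.
move=> uv; rewrite [p]malg_mterm mulr_suml raddf_sum big1 //= => m _.
by rewrite mulrBr !mterm_mon raddfB /= !phi_mterm !vdegM uv subrr.
Qed.

Lemma mcoeff_mul_binomial_eq0 (p : RR K) u v x :
  (forall m, mmul m u <> x) -> (forall m, mmul m v <> x) ->
  (p * (mon K u - mon K v))@_x = 0.
Proof.
move=> ux vx; rewrite [p]malg_mterm mulr_suml raddf_sum big1 //= => m _.
rewrite mulrBr !mterm_mon mcoeffB !mcoeff_mterm.
by case: eqP => [/ux//|_]; case: eqP => [/vx//|_]; rewrite subr0.
Qed.

End MapsOnMonomials.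

(** * Congruences modulo a generated ideal *)

Section GeneratedIdeal.
Context (K : fieldType) (P : RR K -> Prop).
Implicit Types (f g : RR K) (u v m : cmonom E).

Lemma ideal_gen0 : ideal_gen P 0.
Proof. by exists [::]; split=> //; rewrite big_nil. Qed.

Lemma ideal_genD f g : ideal_gen P f -> ideal_gen P g -> ideal_gen P (f + g).
Proof.
move=> [l [Pl ->]] [l' [Pl' ->]]; exists (l ++ l'); split; last by rewrite big_cat.
by move=> p; rewrite mem_cat => /orP[/Pl|/Pl'].
Qed.

Lemma ideal_genM f g : ideal_gen P g -> ideal_gen P (f * g).
Proof.
move=> [l [Pl ->]]; exists [seq (f * p.1, p.2) | p <- l]; split.
  by move=> _ /mapP[p pl ->] /=; apply: Pl.
by rewrite big_map mulr_sumr; apply: eq_bigr => p _; rewrite mulrA.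
Qed.

Lemma ideal_gen_mem g : P g -> ideal_gen P g.
Proof.
move=> Pg; exists [:: (1, g)]; split; last by rewrite big_seq1 mul1r.
by move=> p; rewrite inE => /eqP->.
Qed.

Definition mcong u v := ideal_gen P (mon K u - mon K v).

Lemma mcong_refl u : mcong u u.
Proof. by rewrite /mcong subrr; apply: ideal_gen0. Qed.

Lemma mcong_sym u v : mcong u v -> mcong v u.
Proof. by move=> uv; rewrite /mcong -opprB -mulN1r; apply: ideal_genM. Qed.

Lemma mcong_trans v u m : mcong u v -> mcong v m -> mcong u m.
Proof.
by move=> uv vm; rewrite /mcong -[_ - _](subrKA (mon K v)); apply: ideal_genD.
Qed.

Lemma mcongM m u v : mcong u v -> mcong (mmul m u) (mmul m v).
Proof. by move=> uv; rewrite /mcong -!monM -mulrBr; apply: ideal_genM. Qed.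

(* Replacing every monomial of [f] by a fixed representative of its fibre
   changes [f] by an element of the ideal, and turns [f] into the image of
   [phi f] under a linear map. *)
Lemma toric_ideal_sub : (forall u v, vdeg u = vdeg v -> mcong u v) ->
  forall f, phi f = 0 -> ideal_gen P f.
Proof.
move=> congr_fibre f phif0.
(* The default [mone] is never taken at a degree that occurs in [f]. *)
pose rep d := head mone [seq m <- msupp f | vdeg m == d].
have rep_vdeg m : m \in msupp f -> vdeg (rep (vdeg m)) = vdeg m.
  move=> mf; have: m \in [seq m' <- msupp f | vdeg m' == vdeg m].
    by rewrite mem_filter eqxx.
  rewrite /rep; case e: [seq _ <- _ | _] => [//|m' s] _ /=.
  by have: m' \in m' :: s; [exact: mem_head|rewrite -e mem_filter => /andP[/eqP]].
have reps0 : \sum_(m <- msupp f) mterm (f@_m) (rep (vdeg m)) = 0.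
  pose psi : SS K -> RR K := mmap (fun c : K => c%:MP) (fun d => mon K (rep d)).
  have psiB : zmod_morphism psi by exact: mmap_is_additive.
  pose psiA := GRing.isZmodMorphism.Build _ _ psi psiB.
  pose psi' : {additive SS K -> RR K} := HB.pack psi psiA.
  have psi_phi : psi' (phi f) = 0 by rewrite phif0 raddf0.
  rewrite -[RHS]psi_phi [in RHS](malg_mterm f) (raddf_sum (@phi K)) (raddf_sum psi').
  apply: eq_bigr => m _.
  by rewrite /= phi_mterm /psi mmap_mterm mterm_mon mul1m.
have -> : f = \sum_(m <- msupp f) mterm (f@_m) mone * (mon K m - mon K (rep (vdeg m))).
  under eq_bigr => m _ do rewrite mulrBr !mterm_mon !mul1m.
  by rewrite sumrB reps0 subr0 -malg_mterm.
rewrite big_seq; apply: (big_ind (ideal_gen P)) => [||m mf].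
- exact: ideal_gen0.
- exact: ideal_genD.
by apply/ideal_genM/congr_fibre; rewrite rep_vdeg.
Qed.

End GeneratedIdeal.

(** * The weights of the binomials [g^s] *)

Section WeightMonomials.
Implicit Types (f : nat -> nat -> nat) (N : nat).

Definition wmon f N : cmonom E :=
  \big[mmul/mone]_(1 <= i < N)
    mmul (expcmn (xm i i.+1) (f i i.+1)) (expcmn (xm i i.+2) (f i i.+2)).

Lemma emult_wmon f N p : emult (wmon f N) p =
  (\sum_(1 <= i < N) (f i i.+1 * emult (xm i i.+1) p + f i i.+2 * emult (xm i i.+2) p))%N.
Proof.
have emult1 : emult mone p = 0%N by rewrite /emult; case: insub => // e; rewrite cm1.
rewrite /wmon (big_morph (emult^~ p) (fun x y => emultM x y p) emult1).
have emultX m n : emult (expcmn m n) p = (n * emult m p)%N.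
  by rewrite /emult; case: insub => [e|]; rewrite ?expcmnE ?muln0.
by apply: eq_bigr => i _; rewrite emultM !emultX.
Qed.

Lemma sum_nat_pick (F : nat -> nat) N j :
  (\sum_(1 <= i < N) F i * (i == j))%N = if (0 < j < N)%N then F j else 0%N.
Proof.
case: ifP => [jN|njN].
  rewrite (bigD1_seq j) ?mem_index_iota ?iota_uniq //= eqxx muln1.
  by rewrite big1 ?addn0 // => i /negbTE->; rewrite muln0.
rewrite big_nat big1 // => i iN; case: eqP iN => [->|]; rewrite ?muln0 //.
by rewrite njN.
Qed.

Lemma short_wmon f N j :
  short (wmon f N) j = if (0 < j < N)%N then f j j.+1 else 0%N.
Proof.
rewrite /short emult_wmon -(sum_nat_pick (fun i => f i i.+1)) big_nat [RHS]big_nat.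
apply: eq_bigr => i /andP[i0 _].
by rewrite -!/(short _ _) !xm_simpl // muln0 addn0.
Qed.

Lemma long_wmon f N j :
  long (wmon f N) j = if (0 < j < N)%N then f j j.+2 else 0%N.
Proof.
rewrite /long emult_wmon -(sum_nat_pick (fun i => f i i.+2)) big_nat [RHS]big_nat.
apply: eq_bigr => i /andP[i0 _].
by rewrite -!/(long _ _) !xm_simpl // muln0.
Qed.

Lemma binom_of_wmon (K : fieldType) w N :
  binom_of K w N = mon K (wmon (fun i j => pospart (w i j)) N)
                 - mon K (wmon (fun i j => pospart (- w i j)) N).
Proof.
rewrite /binom_of /wmon -!mon_prod.
congr (_ - _); rewrite big_nat [RHS]big_nat; apply: eq_bigr => i /andP[i0 _].
  by rewrite -monM -!monX !xv_monom //; rewrite /Epred /=; lia.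
by rewrite -monM -!monX !xv_monom //; rewrite /Epred /=; lia.
Qed.

End WeightMonomials.

(** The degree of vertex [n] in the positive monomial of the binomial; for a balanced weight the
    negative monomial has the same degree. *)
Definition posdeg (w : nat -> nat -> int) (n : nat) : nat :=
  (pospart (w n n.+1) + pospart (w n n.+2)
   + pospart (w n.-1 n.-1.+1) + pospart (w n.-2 n.-2.+2))%N.

Lemma posdeg_eq w w' n : w n n.+1 = w' n n.+1 -> w n n.+2 = w' n n.+2 ->
  w n.-1 n.-1.+1 = w' n.-1 n.-1.+1 -> w n.-2 n.-2.+2 = w' n.-2 n.-2.+2 ->
  posdeg w n = posdeg w' n.
Proof. by rewrite /posdeg => -> -> -> ->. Qed.

Lemma posdeg_eq0 w n : w n n.+1 = 0 -> w n n.+2 = 0 ->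
  w n.-1 n.-1.+1 = 0 -> w n.-2 n.-2.+2 = 0 -> posdeg w n = 0%N.
Proof. by rewrite /posdeg => -> -> -> ->. Qed.

(* The weight [w] of some [g^s]: two odd triangles joined by a path which
   reaches the second triangle [q+2, q+3, q+4] through the edge [q, q+2];
   thus [q + 4] is the largest vertex, and [c] the sign of the edges at [q+2]
   in this triangle. [walk_tight] says that the graph is an induced subgraph. *)
Record walk (w : nat -> nat -> int) (N q : nat) (c : int) : Prop := Walk {
  walk_sign : c = 1 \/ c = -1;
  walk_q : (3 <= q)%N;
  walk_N : (q + 4 <= N)%N;
  walk_short0 : w 0 1 = 0;
  walk_long0 : w 0 2 = 0;
  walk_short1 : w 1 2 = 1;
  walk_long1 : w 1 3 = -1;
  walk_last : w q q.+2 = - (2 * c);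
  walk_short : forall i, (q < i)%N ->
    w i i.+1 = if i == q.+2 then c else if i == q.+3 then - c else 0;
  walk_long : forall i, (q < i)%N -> w i i.+2 = if i == q.+2 then c else 0;
  walk_balanced : forall n,
    w n n.+1 + w n n.+2 + w n.-1 n.-1.+1 + w n.-2 n.-2.+2 = 0;
  walk_gap : posdeg w q.+1 = 0%N;
  walk_tight : forall n, (1 < n < q.+2)%N ->
    [\/ posdeg w n = 0%N, posdeg w n.+1 = 0%N | posdeg w n.+2 = 0%N] }.

Section WalkStep.
Context (w : nat -> nat -> int) (N q : nat) (c : int).
Hypothesis Ww : walk w N q c.

Let c0 : c != 0. Proof. by case: (walk_sign Ww) => ->. Qed.

Lemma lvert_walk : lvert w N = (q + 4)%N.
Proof.
have qN := walk_N Ww; rewrite /lvert; apply/eqP; rewrite eqn_leq; apply/andP; split.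
  apply/bigmax_leqP_seq => i _ _; rewrite geq_max.
  have [iq|qi] := leqP i q.+2; first by apply/andP; split; case: ifP => _; lia.
  rewrite (walk_long Ww) ?(walk_short Ww); try lia.
  rewrite (_ : (i == q.+2) = false); last by lia.
  by rewrite eqxx /= andbT; case: (i =P q.+3) => [->|_]; rewrite ?eqxx //; case: ifP; lia.
have iN : q.+2 \in index_iota 1 N by rewrite mem_index_iota; lia.
apply: leq_trans (leq_bigmax_seq _ iN isT); rewrite leq_max.
by rewrite (walk_long Ww) // eqxx c0 addn4 leqnn orbT.
Qed.

Let leE_short i : leE i i.+1 (lvert w N - 4) (lvert w N - 2) = (i <= q)%N.
Proof. by rewrite lvert_walk /leE; lia. Qed.

Let leE_long i : leE i i.+2 (lvert w N - 4) (lvert w N - 2) = (i <= q)%N.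
Proof. by rewrite lvert_walk /leE; lia. Qed.

Lemma step1_short i : step1 w N i i.+1 =
  if (i <= q)%N then w i i.+1
  else if i == q.+4 then - c else if i == q.+4.+1 then c else 0.
Proof.
rewrite /step1 leE_short; case: ifP => // qi; rewrite lvert_walk.
rewrite (_ : _ && _ = false); last by lia.
rewrite (_ : leE _ _ _ _ = (q.+4 <= i)%N); last by rewrite /leE; lia.
case: ifP => i4; last by do !case: ifP; lia.
rewrite subSn; last by lia.
rewrite (walk_short Ww); last by lia.
rewrite (_ : (_ == q.+2) = (i == q.+4)); last by lia.
rewrite (_ : (_ == q.+3) = (i == q.+4.+1)); last by lia.
by do 2!case: eqP => // _; rewrite ?opprK ?oppr0.
Qed.

Lemma step1_long i : step1 w N i i.+2 =
  if (i <= q)%N then w i i.+2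
  else if i == q.+2 then 2 * c else if i == q.+4 then - c else 0.
Proof.
rewrite /step1 leE_long; case: ifP => // qi; rewrite lvert_walk.
rewrite (_ : _ && _ = (i == q.+2)); last by lia.
case: eqP => [->|iq]; first by rewrite (walk_long Ww) ?eqxx.
rewrite (_ : leE _ _ _ _ = (q.+4 <= i)%N); last by rewrite /leE; lia.
case: ifP => i4; last by do !case: ifP; lia.
rewrite 2?subSn; try lia.
rewrite (walk_long Ww); last by lia.
rewrite (_ : (_ == q.+2) = (i == q.+4)); last by lia.
by case: eqP => // _; rewrite oppr0.
Qed.

Lemma step2_short i : step2 w N i i.+1 =
  if (i <= q)%N then w i i.+1
  else if i == q.+2 then 2 * c
  else if i == q.+4.+1 then c else if i == q.+4.+2 then - c else 0.
Proof.
rewrite /step2 leE_short; case: ifP => // qi; rewrite lvert_walk.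
rewrite (_ : _ && _ = (i == q.+2)); last by lia.
case: eqP => [->|iq]; first by rewrite (walk_short Ww) ?eqxx.
rewrite (_ : _ && _ = false); last by lia.
rewrite (_ : leE _ _ _ _ = (q.+4.+1 <= i)%N); last by rewrite /leE; lia.
case: ifP => i4; last by do !case: ifP; lia.
rewrite subSn; last by lia.
rewrite (walk_short Ww); last by lia.
rewrite (_ : (_ == q.+2) = (i == q.+4.+1)); last by lia.
by rewrite (_ : (_ == q.+3) = (i == q.+4.+2)); last by lia.
Qed.

Lemma step2_long i : step2 w N i i.+2 =
  if (i <= q)%N then w i i.+2
  else if i == q.+3 then - (2 * c) else if i == q.+4.+1 then c else 0.
Proof.
rewrite /step2 leE_long; case: ifP => // qi; rewrite lvert_walk.
rewrite (_ : _ && _ = false); last by lia.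
rewrite (_ : _ && _ = (i == q.+3)); last by lia.
case: eqP => [_|iq].
  rewrite (_ : (_ - 2)%N = q.+2); last by lia.
  rewrite (_ : (_ - 1)%N = q.+3); last by lia.
  by rewrite (walk_short Ww) ?eqxx.
rewrite (_ : leE _ _ _ _ = (q.+4.+1 <= i)%N); last by rewrite /leE; lia.
case: ifP => i4; last by do !case: ifP; lia.
rewrite 2?subSn; try lia.
rewrite (walk_long Ww); last by lia.
by rewrite (_ : (_ == q.+2) = (i == q.+4.+1)); last by lia.
Qed.

(** Rule 1 lengthens the path by one double edge, [q+2, q+4]. Signs alternate along the path, so the
    triangle, moved by two, changes sign. *)
Lemma walk_step1 : walk (step1 w N) (N + 3) q.+2 (- c).
Proof.
have q3 := walk_q Ww; have qN := walk_N Ww.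
have [s0 l0] := (walk_short0 Ww, walk_long0 Ww).
have [s1 l1] := (walk_short1 Ww, walk_long1 Ww).
have Ss := step1_short; have Sl := step1_long.
(* The rule keeps [w] up to [q] only, but both weights vanish on the edges that start at q+1. *)
have le_s i : (i <= q.+1)%N -> step1 w N i i.+1 = w i i.+1.
  move=> iq; rewrite Ss; case: leqP => // qi.
  by rewrite (walk_short Ww qi); do !case: ifP; lia.
have le_l i : (i <= q.+1)%N -> step1 w N i i.+2 = w i i.+2.
  move=> iq; rewrite Sl; case: leqP => // qi.
  by rewrite (walk_long Ww qi); do !case: ifP; lia.
have le_deg n : (n <= q.+1)%N -> posdeg (step1 w N) n = posdeg w n.
  by move=> nq; apply: posdeg_eq; rewrite ?le_s ?le_l //; lia.
have gap1 : posdeg (step1 w N) q.+3 = 0%N.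
  by apply: posdeg_eq0; rewrite /= ?Ss ?Sl; do !case: ifP => //; lia.
split=> //.
- by case: (walk_sign Ww) => ->; [right|left]; rewrite ?opprK.
- by lia.
- by lia.
- by rewrite le_s.
- by rewrite le_l.
- by rewrite le_s //; lia.
- by rewrite le_l //; lia.
- by rewrite Sl; do !case: ifP; lia.
- by move=> i qi; rewrite Ss; do !case: ifP; lia.
- by move=> i qi; rewrite Sl; do !case: ifP; lia.
- move=> n; have [nq|qn] := leqP n q.+1.
    by rewrite !le_s ?le_l ?(walk_balanced Ww) //; lia.
  have [->|nq2] := eqVneq n q.+2.
    by rewrite /= (le_l q) // (walk_last Ww) !Ss !Sl; do !case: ifP; lia.
  by rewrite !Ss !Sl; do !case: ifP; lia.
move=> n /andP[n1 nq]; have [nq1|qn1] := leqP n.+2 q.+1.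
  by rewrite !le_deg; try lia; apply: (walk_tight Ww); lia.
(* The isolated vertices q+1 and q+3 settle the remaining values of [n]. *)
have gap := walk_gap Ww; rewrite -le_deg // in gap.
have: n = q \/ n = q.+1 \/ n = q.+2 \/ n = q.+3 by lia.
by case=> [->|[->|[->|->]]]; [apply: Or32|apply: Or31|apply: Or32|apply: Or31].
Qed.

(** Rule 2 lengthens the path by two double edges, [q+2, q+3] and [q+3, q+5], so the triangle, moved
    by three, keeps its sign. *)
Lemma walk_step2 : walk (step2 w N) (N + 3) q.+3 c.
Proof.
have q3 := walk_q Ww; have qN := walk_N Ww.
have [s0 l0] := (walk_short0 Ww, walk_long0 Ww).
have [s1 l1] := (walk_short1 Ww, walk_long1 Ww).
have Ss := step2_short; have Sl := step2_long.
have le_s i : (i <= q.+1)%N -> step2 w N i i.+1 = w i i.+1.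
  move=> iq; rewrite Ss; case: leqP => // qi.
  by rewrite (walk_short Ww qi); do !case: ifP; lia.
have le_l i : (i <= q.+1)%N -> step2 w N i i.+2 = w i i.+2.
  move=> iq; rewrite Sl; case: leqP => // qi.
  by rewrite (walk_long Ww qi); do !case: ifP; lia.
have le_deg n : (n <= q.+1)%N -> posdeg (step2 w N) n = posdeg w n.
  by move=> nq; apply: posdeg_eq; rewrite ?le_s ?le_l //; lia.
have gap1 : posdeg (step2 w N) q.+4 = 0%N.
  by apply: posdeg_eq0; rewrite /= ?Ss ?Sl; do !case: ifP => //; lia.
split=> //.
- exact: walk_sign Ww.
- by lia.
- by rewrite le_s.
- by rewrite le_l.
- by rewrite le_s //; lia.
- by rewrite le_l //; lia.
- by rewrite Sl; do !case: ifP; lia.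
- by move=> i qi; rewrite Ss; do !case: ifP; lia.
- by move=> i qi; rewrite Sl; do !case: ifP; lia.
- move=> n; have [nq|qn] := leqP n q.+1.
    by rewrite !le_s ?le_l ?(walk_balanced Ww) //; lia.
  have [->|nq2] := eqVneq n q.+2.
    by rewrite /= (le_l q) // (walk_last Ww) !Ss !Sl; do !case: ifP; lia.
  by rewrite !Ss !Sl; do !case: ifP; lia.
move=> n /andP[n1 nq]; have [nq1|qn1] := leqP n.+2 q.+1.
  by rewrite !le_deg; try lia; apply: (walk_tight Ww); lia.
(* Here the isolated vertices are q+1 and q+4. *)
have gap := walk_gap Ww; rewrite -le_deg // in gap.
have: n = q \/ n = q.+1 \/ n = q.+2 \/ n = q.+3 \/ n = q.+4 by lia.
by case=> [->|[->|[->|[->|->]]]];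
  [apply: Or32|apply: Or31|apply: Or33|apply: Or32|apply: Or31].
Qed.

End WalkStep.

Definition wN (s : seq nat) := foldl wstep (w0, 7%N) s.

Lemma wN_rcons s d : wN (rcons s d) = wstep (wN s) d.
Proof. exact: foldl_rcons. Qed.

Definition digits (s : seq nat) := all (fun d => (d == 1%N) || (d == 2%N)) s.

Lemma digits_rcons s d :
  digits (rcons s d) = ((d == 1%N) || (d == 2%N)) && digits s.
Proof. exact: all_rcons. Qed.

(** The triangles {1,2,3} and {5,6,7} are joined by the double edge [3,5], and vertex 4 is
    isolated. *)
Lemma walk_w0 : walk w0 7 3 (-1).
Proof.
split=> //; first by right.
- by do 7?case=> //.
- by do 7?case=> //.
- by do 10?case=> //.
by do 6?case=> //; move=> _; [apply: Or33|apply: Or32|apply: Or31].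
Qed.

Lemma walk_wN s : digits s -> exists q c, walk (wN s).1 (wN s).2 q c.
Proof.
elim/last_ind: s => [|s d IHs]; first by exists 3%N, (-1); apply: walk_w0.
rewrite digits_rcons => /andP[d12 /IHs[q [c Ww]]].
rewrite wN_rcons /wstep /=; case: ifP => _.
  by exists q.+2, (- c); apply: walk_step1.
by exists q.+3, c; apply: walk_step2.
Qed.

(** * Connectivity of the fibres *)

Lemma pospartP z : z <= 0 /\ pospart z = 0%N \/ 0 < z /\ z = (pospart z)%:Z.
Proof. by case: z => [[|n]|n]; [left|right|left]. Qed.

Section WalkMonomials.
Context (w : nat -> nat -> int) (N q : nat) (c : int).
Hypothesis Ww : walk w N q c.
Context (f : int -> int).
Hypothesis f0 : f 0 = 0.

(** The cut at [N] loses nothing, since [w] vanishes beyond it. Taking [f] to be the identity or the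
    negation covers both monomials of the binomial. *)
Lemma short_wmon_walk i :
  short (wmon (fun i j => pospart (f (w i j))) N) i = pospart (f (w i i.+1)).
Proof.
rewrite short_wmon; case: ifP => // iN; have qN := walk_N Ww.
have [->|i0] := eqVneq i 0%N; first by rewrite (walk_short0 Ww) f0.
by rewrite (walk_short Ww) ?f0; do ?case: ifP; rewrite ?f0 //; lia.
Qed.

Lemma long_wmon_walk i :
  long (wmon (fun i j => pospart (f (w i j))) N) i = pospart (f (w i i.+2)).
Proof.
rewrite long_wmon; case: ifP => // iN; have qN := walk_N Ww.
have [->|i0] := eqVneq i 0%N; first by rewrite (walk_long0 Ww) f0.
by rewrite (walk_long Ww) ?f0; do ?case: ifP; rewrite ?f0 //; lia.
Qed.

End WalkMonomials.

Definition gs_pos s := wmon (fun i j => pospart ((wN s).1 i j)) (wN s).2.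
Definition gs_neg s := wmon (fun i j => pospart (- (wN s).1 i j)) (wN s).2.

Lemma gs_binomial (K : fieldType) s : gs K s = mon K (gs_pos s) - mon K (gs_neg s).
Proof. exact: binom_of_wmon. Qed.

(** * Congruences that contain the moves by shifted generators *)

Section Connectivity.
Context (R : cmonom E -> cmonom E -> Prop).
Implicit Types (u v x y : cmonom E) (i j k q : nat).

Hypotheses (Rrefl : forall u, R u u) (Rsym : forall u v, R u v -> R v u).
Hypothesis Rtrans : forall v u x, R u v -> R v x -> R u x.
Hypothesis RM : forall x u v, R u v -> R (mmul x u) (mmul x v).
Hypothesis Rvdeg : forall u v, R u v -> vdeg u = vdeg v.
Hypothesis Rquad : forall i, (0 < i)%N ->
  R (mmul (xm i i.+1) (xm i.+2 i.+3)) (mmul (xm i i.+2) (xm i.+1 i.+3)).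
Hypothesis Rwalk : forall s k, digits s -> R (shm k (gs_pos s)) (shm k (gs_neg s)).

(** The factor [a] of [u] is replaced by [b]. Exponents are compared by sums to avoid truncated
    subtraction. *)
Lemma move a b u : R a b -> (forall i, short a i <= short u i)%N ->
  (forall i, long a i <= long u i)%N ->
  exists u', [/\ R u u',
    forall i, (short u' i + short a i = short u i + short b i)%N &
    forall i, (long u' i + long a i = long u i + long b i)%N].
Proof.
move=> ab les lel; have eu := divmK les lel; set d := divcm u a in eu.
exists (mmul d b); split=> [|i|i].
- by rewrite {1}eu mulmC; apply: RM.
- by rewrite [in RHS]eu !shortM; lia.
- by rewrite [in RHS]eu !longM; lia.
Qed.

Lemma move_short u i : (0 < short u i)%N -> (0 < short u i.+2)%N ->
  exists u', [/\ R u u',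
    forall j, (short u' j + ((i == j) + (i.+2 == j)) = short u j)%N &
    forall j, (long u' j = long u j + ((i == j) + (i.+1 == j)))%N].
Proof.
move=> ui ui2; have i0 : (0 < i)%N by case: i ui {ui2} => //; rewrite short0.
have [j|j|u' [uu' Hs Hl]] := move (u := u) (Rquad i0).
- rewrite shortM !xm_simpl //.
  by case: eqP => [<-|_]; [rewrite gtn_eqF ?addn0|case: eqP => [<-|]]; lia.
- by rewrite longM !xm_simpl.
by exists u'; split=> // j; [have := Hs j|have := Hl j];
  rewrite ?shortM ?longM !xm_simpl //; lia.
Qed.

Lemma move_long u i : (0 < long u i)%N -> (0 < long u i.+1)%N ->
  exists u', [/\ R u u',
    forall j, (long u' j + ((i == j) + (i.+1 == j)) = long u j)%N &
    forall j, (short u' j = short u j + ((i == j) + (i.+2 == j)))%N].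
Proof.
move=> ui ui1; have i0 : (0 < i)%N by case: i ui {ui1} => //; rewrite long0.
have [j|j|u' [uu' Hs Hl]] := move (u := u) (Rsym (Rquad i0)).
- by rewrite shortM !xm_simpl.
- rewrite longM !xm_simpl //.
  by case: eqP => [<-|_]; [rewrite gtn_eqF ?addn0|case: eqP => [<-|]]; lia.
by exists u'; split=> // j; [have := Hl j|have := Hs j];
  rewrite ?shortM ?longM !xm_simpl //; lia.
Qed.

(** Divisibility of [u] by a prefix: the monomial of sign [e] of [w], shifted by [k] and restricted
    to the edges that start before [n]. *)
Definition dom (e : int) (w : nat -> nat -> int) k n u := forall i, (i < n)%N ->
  (pospart (e * w i i.+1) <= short u (i + k))%N /\
  (pospart (e * w i i.+2) <= long u (i + k))%N.

Lemma eq_dom e w k n u v : (forall i, (i < n + k)%N -> short u i = short v i) ->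
  (forall i, (i < n + k)%N -> long u i = long v i) -> dom e w k n u -> dom e w k n v.
Proof. by move=> es el D i i_n; have := D i i_n; rewrite es ?el //; lia. Qed.

Lemma move_walk s q c (e : int) k u : digits s -> walk (wN s).1 (wN s).2 q c ->
  e = 1 \/ e = -1 -> (forall n, dom e (wN s).1 k n u) ->
  exists u', R u u' /\ forall n, dom (- e) (wN s).1 k n u'.
Proof.
move=> ds Ww e1 D.
(* [a] and [b] are the two monomials of the shifted binomial, swapped when [e] is -1. *)
have [a [b [ab [as_ al] [bs bl]]]] : exists a b, [/\ R a b,
    (forall i, short a i = pospart (e * (wN s).1 (i - k)%N (i - k)%N.+1)) /\
    (forall i, long a i = pospart (e * (wN s).1 (i - k)%N (i - k)%N.+2)) &
    (forall i, short b i = pospart (- e * (wN s).1 (i - k)%N (i - k)%N.+1)) /\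
    (forall i, long b i = pospart (- e * (wN s).1 (i - k)%N (i - k)%N.+2))].
  case: e1 => ->.
    exists (shm k (gs_pos s)), (shm k (gs_neg s)); split; first exact: Rwalk.
      by split=> i; rewrite ?short_shm ?long_shm mul1r
        ?(short_wmon_walk Ww (f := id)) ?(long_wmon_walk Ww (f := id)).
    by split=> i; rewrite ?short_shm ?long_shm mulN1r
      ?(short_wmon_walk Ww (f := -%R)) ?(long_wmon_walk Ww (f := -%R)).
  exists (shm k (gs_neg s)), (shm k (gs_pos s)); split; first exact/Rsym/Rwalk.
    by split=> i; rewrite ?short_shm ?long_shm mulN1r
      ?(short_wmon_walk Ww (f := -%R)) ?(long_wmon_walk Ww (f := -%R)).
  by split=> i; rewrite ?short_shm ?long_shm opprK mul1r
    ?(short_wmon_walk Ww (f := id)) ?(long_wmon_walk Ww (f := id)).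
have [i|i|u' [uu' Hs Hl]] := move (u := u) ab.
- rewrite as_; have [ki|ik] := leqP k i.
    by have [+ _] := D (i - k).+1 (i - k)%N (ltnSn _); rewrite subnK.
  by rewrite (_ : (i - k)%N = 0%N) ?(walk_short0 Ww) ?mulr0 //; lia.
- rewrite al; have [ki|ik] := leqP k i.
    by have [_ +] := D (i - k).+1 (i - k)%N (ltnSn _); rewrite subnK.
  by rewrite (_ : (i - k)%N = 0%N) ?(walk_long0 Ww) ?mulr0 //; lia.
exists u'; split=> // n i _; have [Ds Dl] := D i.+1 i (ltnSn _).
have := Hs (i + k)%N; have := Hl (i + k)%N.
have le_exchange (m m' d d' : nat) : (d <= m -> m' + d = m + d' -> d' <= m')%N by lia.
rewrite as_ al bs bl addnK => el es.
by split; [apply: le_exchange Ds es|apply: le_exchange Dl el].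
Qed.

(** The situation of a minimal counterexample: a common edge could be cancelled. *)
Definition rigid u v := forall u' v', R u u' -> R v v' -> forall i,
  ((0 < short u' i) -> (0 < short v' i) -> False)%N /\
  ((0 < long u' i) -> (0 < long v' i) -> False)%N.

Lemma rigid_sym u v : rigid u v -> rigid v u.
Proof.
move=> r v' u' vv' uu' i; have [rs rl] := r _ _ uu' vv' i.
by split=> ? ?; [apply: rs|apply: rl].
Qed.

(** A complete monomial of sign [e] can be exchanged for the one of sign [-e], whose edge at the
    first vertex already lies in [y]: [1,3] if [e] is 1, [1,2] otherwise, up to the shift. *)
Lemma walk_clash s q c (e : int) k x x1 y : digits s -> walk (wN s).1 (wN s).2 q c ->
  e = 1 \/ e = -1 -> rigid x y -> R x x1 -> (forall n, dom e (wN s).1 k n x1) ->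
  dom (- e) (wN s).1 k q.+1 y -> False.
Proof.
move=> ds Ww e1 r xx1 Dx Dy; have [x' [x1x' Dx']] := move_walk ds Ww e1 Dx.
have [rs rl] := r _ _ (Rtrans xx1 x1x') (Rrefl y) (1 + k)%N.
have [xs xl] := Dx' 2%N 1%N isT.
have [|ys yl] := Dy 1%N; first by have := walk_q Ww; lia.
move: xs xl ys yl; rewrite (walk_short1 Ww) (walk_long1 Ww).
by case: e1 => -> xs xl ys yl; [exact: (rl xl yl)|exact: (rs xs ys)].
Qed.

(** An unfinished walk: up to the double edge [q, q+2], which lies in [u], the two monomials contain
    the two signs of the shifted weight. The last two fields exclude edges at q+1 that would spoil
    the degree counts at q+2 and q+3. *)
Record state s q c k u v : Prop := State {
  state_digits : digits s;
  state_walk : walk (wN s).1 (wN s).2 q c;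
  state_domu : dom (- c) (wN s).1 k q.+1 u;
  state_domv : dom c (wN s).1 k q.+1 v;
  state_gapu : long u (q + k).+1 = 0%N;
  state_gapv : short v (q + k).+1 = 0%N }.

Section StateStep.
Context (s : seq nat) (q : nat) (c : int) (k : nat) (u v : cmonom E).
Hypotheses (uv : vdeg u = vdeg v) (r : rigid u v) (S : state s q c k u v).

Local Notation w := (wN s).1.
Let Ww : walk w (wN s).2 q c := state_walk S.
Let p := (q + k)%N.

Lemma state_last : (1 < long u p)%N.
Proof.
have [_] := state_domu S (ltnSn q); rewrite (walk_last Ww).
by case: (walk_sign Ww) => ->.
Qed.

(** In the second triangle only [q+3, q+4] has sign [-c], so this edge would complete the monomial
    in [u1]. *)
Lemma clash_u u1 : R u u1 -> dom (- c) w k q.+1 u1 -> short u1 p.+3 = 0%N.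
Proof.
move=> uu1 D; apply/eqP; rewrite -leqn0 leqNgt; apply/negP => u13.
apply: (walk_clash (state_digits S) Ww _ r uu1 (e := - c) (k := k)).
- by case: (walk_sign Ww) => ->; [right|left]; rewrite ?opprK.
- move=> n i _; have [iq|qi] := leqP i q; first exact: D.
  rewrite (walk_short Ww qi) (walk_long Ww qi).
  have [->|i2] := eqVneq i q.+2; first by case: (walk_sign Ww) => ->.
  have [->|i3] := eqVneq i q.+3; last by rewrite mulr0.
  by rewrite mulr0; split=> //; move: u13; rewrite /p; case: (walk_sign Ww) => ->.
by rewrite opprK; apply: state_domv S.
Qed.

(** The two edges at q+2 of the second triangle have sign [c] and would complete the other
    monomial. *)
Lemma clash_v v1 : R v v1 -> dom c w k q.+1 v1 ->
  (0 < short v1 p.+2)%N -> (0 < long v1 p.+2)%N -> False.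
Proof.
move=> vv1 D v1s v1l.
apply: (walk_clash (state_digits S) Ww _ (rigid_sym r) vv1 (e := c) (k := k)).
- exact: walk_sign Ww.
- move=> n i _; have [iq|qi] := leqP i q; first exact: D.
  rewrite (walk_short Ww qi) (walk_long Ww qi).
  have [->|i2] := eqVneq i q.+2.
    by move: v1s v1l; rewrite /p; case: (walk_sign Ww) => ->.
  have [->|i3] := eqVneq i q.+3; last by rewrite mulr0.
  by rewrite mulr0; split=> //; case: (walk_sign Ww) => ->.
exact: state_domu S.
Qed.

Lemma state_step : exists s' q' c', (q < q')%N /\
  (state s' q' c' k v u \/ state s' q' c' k u v).
Proof.
have up := state_last; have cs := walk_sign Ww.
have rs i : (0 < short u i -> 0 < short v i -> False)%N.
  exact: (r (Rrefl u) (Rrefl v) i).1.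
have rl i : (0 < long u i -> 0 < long v i -> False)%N.
  exact: (r (Rrefl u) (Rrefl v) i).2.
have vp : long v p = 0%N by have := rl p; lia.
have up3 : short u p.+3 = 0%N by apply: clash_u (Rrefl u) (state_domu S).
have vp2 := clash_v (Rrefl v) (state_domv S).
have gu : long u p.+1 = 0%N := state_gapu S.
have gv : short v p.+1 = 0%N := state_gapv S.
have dg n : vdeg u n = vdeg v n by rewrite uv.
(* In [v] only [p+2, p+3] and [p+2, p+4] can match the double edge of [u] at p+2. By [vp2] they do
   not both occur, so one of them is at least double. *)
have := dg p.+2; rewrite !vdegE /= vp gv => dg2.
have [vl0|vl] := posnP (long v p.+2); last first.
  have vl2 : (1 < long v p.+2)%N by lia.
  have Ss := step1_short Ww; have Sl := step1_long Ww.
  exists (rcons s 1%N), q.+2, (- c); split; first by lia.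
  (* Rule 1: the last double edge now lies in [v], so the two monomials trade places. *)
  left; split; rewrite ?digits_rcons ?(state_digits S) ?wN_rcons //=.
  - exact: walk_step1.
  - move=> i iq; rewrite opprK Ss Sl; have [iq'|qi] := leqP i q.
      exact: (state_domv S).
    rewrite (_ : (i == q.+4) = false); last by lia.
    rewrite (_ : (i == q.+4.+1) = false); last by lia.
    rewrite mulr0; split=> //; case: eqP => [->|_]; last by rewrite mulr0.
    by move: vl2; rewrite /p !addSn; case: cs => ->.
  - move=> i iq; rewrite Ss Sl; have [iq'|qi] := leqP i q.
      exact: (state_domu S).
    rewrite (_ : (i == q.+4) = false); last by lia.
    rewrite (_ : (i == q.+4.+1) = false); last by lia.
    rewrite mulr0; split=> //; case: eqP => [->|_]; last by rewrite mulr0.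
    by case: cs => ->.
  (* Exchanging [p+2, p+4] and [p+3, p+5] creates [p+2, p+3], while a second copy of [p+2, p+4]
     remains: the triangle closes. *)
  - apply/eqP; rewrite !addSn -/p -leqn0 leqNgt; apply/negP => vl3.
    have [v1 [vv1 Hl Hs]] := move_long vl vl3.
    apply: (clash_v vv1); last by have := Hl p.+2; lia.
      apply: eq_dom (state_domv S) => i ip; [have := Hs i|have := Hl i];
        rewrite /p; lia.
    by have := Hs p.+2; lia.
have vs2 : (1 < short v p.+2)%N by lia.
have us2 : short u p.+2 = 0%N by have := rs p.+2; lia.
(* Rule 2: to match the double edge [p+2, p+3] of [v], only [p+3, p+5] is left to [u] at p+3. *)
have := dg p.+3; rewrite !vdegE /= gu us2 up3 => dg3.
have ul3 : (1 < long u p.+3)%N by lia.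
have Ss := step2_short Ww; have Sl := step2_long Ww.
exists (rcons s 2%N), q.+3, c; split; first by lia.
right; split; rewrite ?digits_rcons ?(state_digits S) ?wN_rcons //=.
- exact: walk_step2.
- move=> i iq; rewrite Ss Sl; have [iq'|qi] := leqP i q.
    exact: (state_domu S).
  rewrite (_ : (i == q.+4.+1) = false); last by lia.
  rewrite (_ : (i == q.+4.+2) = false); last by lia.
  have [->|i2] := eqVneq i q.+2.
    by rewrite (_ : (_ == _) = false); [case: cs => ->|lia].
  rewrite mulr0; split=> //; case: eqP => [->|_]; last by rewrite mulr0.
  by move: ul3; rewrite /p !addSn; case: cs => ->.
- move=> i iq; rewrite Ss Sl; have [iq'|qi] := leqP i q.
    exact: (state_domv S).
  rewrite (_ : (i == q.+4.+1) = false); last by lia.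
  rewrite (_ : (i == q.+4.+2) = false); last by lia.
  have [->|i2] := eqVneq i q.+2.
    rewrite (_ : (_ == _) = false); last by lia.
    by move: vs2; rewrite /p !addSn; case: cs => ->.
  rewrite mulr0; split=> //; case: eqP => [->|_]; last by rewrite mulr0.
  by case: cs => ->.
(* Exchanging [p+3, p+5] and [p+4, p+6] would create [p+3, p+4], which [clash_u] forbids. *)
- apply/eqP; rewrite !addSn -/p -leqn0 leqNgt; apply/negP => ul4.
  have [u1 [uu1 Hl Hs]] := move_long (ltnW ul3) ul4.
  have : short u1 p.+3 = 0%N.
    apply: (clash_u uu1); apply: eq_dom (state_domu S) => i ip;
      [have := Hs i|have := Hl i]; rewrite /p; lia.
  by have := Hs p.+3; lia.
(* Exchanging [p+2, p+3] and [p+4, p+5] in [v] would create [p+3, p+5], an edge of [u]. *)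
- apply/eqP; rewrite !addSn -/p -leqn0 leqNgt; apply/negP => vs4.
  have [v1 [vv1 Hs Hl]] := move_short (ltnW vs2) vs4.
  have [_] := r (Rrefl u) vv1 p.+3; apply; first by lia.
  by have := Hl p.+3; lia.
Qed.

End StateStep.

(** Every step raises [q], yet the edge [q+k, q+k+2] must occur in a fixed finite multigraph;
    induction on a bound for [B - q]. *)
Lemma state_absurd B u v s q c k : vdeg u = vdeg v -> rigid u v ->
  (forall i, (B <= i)%N -> long u i = 0%N /\ long v i = 0%N) ->
  ~ state s q c k u v.
Proof.
move=> uv r uvB; have [n Bqn] : exists n, (B - q <= n)%N by exists (B - q)%N.
elim: n => [|n IHn] in u v s q c uv r uvB Bqn * => S.
  have := state_last S; have [] := uvB (q + k)%N; lia.
have qB : (q + k < B)%N.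
  by rewrite ltnNge; apply/negP => /uvB[]; have := state_last S; lia.
have [s' [q' [c' [qq' []]]]] := state_step uv r S.
  apply: IHn => //; [exact: rigid_sym|by move=> i /uvB[]|lia].
by apply: IHn => //; lia.
Qed.

Lemma long_bounded u : exists B, forall i, (B <= i)%N -> long u i = 0%N.
Proof.
exists (\max_(e <- finsupp u) (val e).1).+1 => i Bi.
rewrite /long /emult; case: insubP => // e _ ei; case: (mdomP u e) => // eu.
have : ((val e).1 <= \max_(e <- finsupp u) (val e).1)%N by apply: leq_bigmax_seq.
by rewrite ei /= => iB; move: Bi; rewrite ltnNge iB.
Qed.

(** Degree counts at b+1 and b+2 produce [b+1, b+2] in [v] and the double edge [b+2, b+4] in [u].
    The shift is b-1 because the walks start at vertex 1. *)
Lemma initial_state u v b : vdeg u = vdeg v -> rigid u v ->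
  (forall i, (i < b)%N -> long u i = 0%N /\ long v i = 0%N) ->
  (0 < short u b)%N -> (0 < long v b)%N -> state [::] 3 (-1) b.-1 u v.
Proof.
move=> uv r below ub vb.
have b0 : (0 < b)%N by case: b ub {below vb} => //; rewrite short0.
have rs i : (0 < short u i -> 0 < short v i -> False)%N.
  exact: (r _ _ (Rrefl u) (Rrefl v) i).1.
have rl i : (0 < long u i -> 0 < long v i -> False)%N.
  exact: (r _ _ (Rrefl u) (Rrefl v) i).2.
have dg n : vdeg u n = vdeg v n by rewrite uv.
have us2 : short u b.+2 = 0%N.
  apply/eqP; rewrite -leqn0 leqNgt; apply/negP => us2.
  have [u1 [uu1 _ Hl]] := move_short ub us2.
  by have [_] := r _ _ uu1 (Rrefl v) b; apply=> //; have := Hl b; lia.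
have vl1 : long v b.+1 = 0%N.
  apply/eqP; rewrite -leqn0 leqNgt; apply/negP => vl1.
  have [v1 [vv1 _ Hs]] := move_long vb vl1.
  by have [+ _] := r _ _ (Rrefl u) vv1 b; apply=> //; have := Hs b; lia.
have [] := below b.-1; first by lia.
move=> ubl vbl; have vs0 : short v b = 0%N by have := rs b; lia.
have ul0 : long u b = 0%N by have := rl b; lia.
have := dg b.+1; rewrite !vdegE /= ubl vbl vl1 vs0 => dg1.
have vs1 : (0 < short v b.+1)%N by lia.
have us1 : short u b.+1 = 0%N by have := rs b.+1; lia.
have := dg b.+2; rewrite !vdegE /= us1 us2 ul0 => dg2.
have ul2 : (1 < long u b.+2)%N by lia.
have e1 j : (j.+1 + b.-1 = j + b)%N by lia.
split=> //; first exact: walk_w0.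
- by do 4?[case=> //]; rewrite /= ?e1 ?add0n.
- by do 4?[case=> //]; rewrite /= ?e1 ?add0n.
(* Two exchanges: the first creates [b+2, b+3], the second combines it with [b, b+1] to create
   [b, b+2], an edge of [v]. *)
- rewrite e1; apply/eqP; rewrite -leqn0 leqNgt; apply/negP => ul3.
  have [u1 [uu1 _ Hs]] := move_long (ltnW ul2) ul3.
  have [||u2 [u1u2 _ Hl]] := @move_short u1 b.
  + by rewrite Hs; lia.
  + by rewrite Hs; lia.
  have [_] := r _ _ (Rtrans uu1 u1u2) (Rrefl v) b; apply=> //.
  by rewrite Hl; lia.
- rewrite e1; apply/eqP; rewrite -leqn0 leqNgt; apply/negP => vs3.
  have [v1 [vv1 _ Hl]] := move_short vs1 vs3.
  have [_] := r _ _ (Rrefl u) vv1 b.+2; apply; first by lia.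
  by rewrite Hl; lia.
Qed.

(** At the least vertex [b] of positive degree each monomial has an edge to the right. These edges
    differ by rigidity, which gives an initial state up to swapping. *)
Lemma rigid_trivial u v : vdeg u = vdeg v -> rigid u v -> vdeg u = mone.
Proof.
move=> uv r; apply/eqP/cmP => n; rewrite cm1; apply/eqP/negPn/negP => un.
have ex_vert : exists n, (0 < vdeg u n)%N by exists n; rewrite lt0n.
case: (ex_minnP ex_vert) => b ub b_min {n un ex_vert}.
have below x i : vdeg x = vdeg u -> (i < b)%N -> short x i = 0%N /\ long x i = 0%N.
  move=> xu ib; have : vdeg x i = 0%N.
    by rewrite xu; apply/eqP; rewrite -leqn0 leqNgt; apply/negP => /b_min; lia.
  by rewrite vdegE; lia.
have b0 : (0 < b)%N by case: b ub {b_min below} => //; rewrite vdegE !short0 !long0.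
have at_b x : vdeg x = vdeg u -> (0 < short x b)%N || (0 < long x b)%N.
  move=> xu; move: ub; rewrite -xu vdegE.
  have [] := below x b.-1 xu; first by lia.
  have [] := below x b.-2 xu; [by lia|lia].
have [Bu HBu] := long_bounded u; have [Bv HBv] := long_bounded v.
have [rs rl] := r _ _ (Rrefl u) (Rrefl v) b.
have ubelow i : (i < b)%N -> long u i = 0%N /\ long v i = 0%N.
  by move=> ib; rewrite (below u i _ ib).2 ?(below v i _ ib).2.
have HB i : (maxn Bu Bv <= i)%N -> long u i = 0%N /\ long v i = 0%N.
  by rewrite geq_max => /andP[ui vi]; rewrite HBu ?HBv.
have [us|us] := posnP (short u b); last first.
  apply: (state_absurd uv r HB (initial_state uv r ubelow us _)).
  by have /orP[/(rs us)|] := at_b v (esym uv).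
have ul : (0 < long u b)%N by have := at_b u erefl; rewrite us.
have HB' i : (maxn Bu Bv <= i)%N -> long v i = 0%N /\ long u i = 0%N by case/HB.
have r' := rigid_sym r.
have vbelow i : (i < b)%N -> long v i = 0%N /\ long u i = 0%N by case/ubelow.
apply: (state_absurd (esym uv) r' HB' (initial_state (esym uv) r' vbelow _ ul)).
by have /orP[//|/(rl ul)] := at_b v (esym uv).
Qed.

Lemma vdeg_eq1 u v : vdeg u = mone -> vdeg v = mone -> u = v.
Proof.
have triv x : vdeg x = mone -> forall i, short x i = 0%N /\ long x i = 0%N.
  by move=> x1 i; have := cm1 i; rewrite -x1 vdegE; lia.
move=> u1 v1; apply: cmonomE_ext => i; have [us ul] := triv u u1 i;
  by have [vs vl] := triv v v1 i; rewrite ?us ?ul ?vs ?vl.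
Qed.

(** Induction on the total degree: if monomials congruent to [u] and [v] share an edge, it is
    cancelled; otherwise the pair is rigid, hence trivial. *)
Lemma fibre_connected u v : vdeg u = vdeg v -> R u v.
Proof.
have [n] : exists n, (mdeg (vdeg u) <= n)%N by exists (mdeg (vdeg u)).
elim: n => [|n IHn] in u v * => un uv.
  have u1 : vdeg u = mone by apply: mdeg_eq0I; lia.
  by rewrite (@vdeg_eq1 u v) // -uv.
apply: NNPP => nR.
have no_common x u' v' : vdeg x <> mone -> R u u' -> R v v' ->
    (forall i, short x i <= short u' i /\ short x i <= short v' i)%N ->
    (forall i, long x i <= long u' i /\ long x i <= long v' i)%N -> False.
  move=> x1 uu' vv' xs xl; apply: nR.
  have eu := divmK (fun i => (xs i).1) (fun i => (xl i).1).
  have ev := divmK (fun i => (xs i).2) (fun i => (xl i).2).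
  set u2 := divcm u' x in eu; set v2 := divcm v' x in ev.
  have e2 : vdeg u' = vdeg v' by rewrite -(Rvdeg uu') uv (Rvdeg vv').
  apply: (Rtrans uu'); apply: Rtrans (Rsym vv'); rewrite eu ev; apply/RM/IHn.
    have : (mdeg (vdeg x) != 0)%N by apply/eqP => /mdeg_eq0I.
    by move: un; rewrite (Rvdeg uu') eu vdegM mdegM; lia.
  apply/eqP/cmP => j; have := congr1 (fun m : cmonom nat => m j) e2.
  by rewrite eu ev !vdegM !cmM; lia.
suff r : rigid u v.
  have u1 := rigid_trivial uv r; apply: nR.
  by rewrite (@vdeg_eq1 u v) // -uv.
move=> u' v' uu' vv' i; split=> ui vi.
  have i0 : (0 < i)%N by case: i ui {vi} => //; rewrite short0.
  apply: (no_common (xm i i.+1) _ _ _ uu' vv') => [x1|j|j].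
  - have := cm1 i; rewrite -x1 vdegE !xm_simpl //; lia.
  - by rewrite xm_simpl //; case: eqP => [<-|].
  - by rewrite xm_simpl.
have i0 : (0 < i)%N by case: i ui {vi} => //; rewrite long0.
apply: (no_common (xm i i.+2) _ _ _ uu' vv') => [x1|j|j].
- have := cm1 i; rewrite -x1 vdegE !xm_simpl //; lia.
- by rewrite xm_simpl.
- by rewrite xm_simpl //; case: eqP => [<-|].
Qed.

End Connectivity.

(** * Indispensable binomials *)

Lemma tight_fibre_unique q (m m' : cmonom E) : vdeg m = vdeg m' ->
  (forall n, (1 < n < q.+2)%N ->
    [\/ vdeg m n = 0%N, vdeg m n.+1 = 0%N | vdeg m n.+2 = 0%N]) ->
  (forall n, (q + 4 < n)%N -> vdeg m n = 0%N) ->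
  short m 1 = short m' 1 -> m = m'.
Proof.
move=> mm' tight far m1.
have dg n : vdeg m n = vdeg m' n by rewrite mm'.
(* Earlier edges and the degree at [n] fix [short m n + long m n]; a vertex of degree 0 among n,
   n+1, n+2 kills one summand or both. *)
have key n : (n < q.+2)%N -> short m n = short m' n /\ long m n = long m' n.
  elim/ltn_ind: n => -[|[|n]] IHn nq; first by rewrite !short0 !long0.
    by have := dg 1%N; rewrite !vdegE !short0 !long0; lia.
  have [s1 l1] := IHn n.+1 (ltnSn _) (ltnW nq).
  have [s0 l0] := IHn n (leqnSn _) (ltnW (ltnW nq)).
  have := dg n.+2; have := dg n.+3; have := dg n.+4.
  by case: (tight n.+2) => // d0; rewrite !vdegE /= in d0 *; lia.
have far' n : (q + 4 < n)%N ->
    [/\ short m n.-1 = 0%N, long m n.-2 = 0%N, short m' n.-1 = 0%N & long m' n.-2 = 0%N].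
  by move=> /far; have := dg n; rewrite !vdegE; split; lia.
have [s4 l3 s4' l3'] : [/\ short m q.+4 = 0%N, long m q.+3 = 0%N,
    short m' q.+4 = 0%N & long m' q.+3 = 0%N] by apply: (far' q.+4.+1); lia.
have [s5 l4 s5' l4'] : [/\ short m q.+4.+1 = 0%N, long m q.+4 = 0%N,
    short m' q.+4.+1 = 0%N & long m' q.+4 = 0%N] by apply: (far' q.+4.+2); lia.
have [a1 b1] := key q.+1 (ltnSn _); have [a0 b0] := key q (leqnSn _).
(* The three edges of the last triangle are determined by its three degrees because the cycle is
   odd. *)
have := dg q.+2; have := dg q.+3; have := dg q.+4; rewrite !vdegE /= => d4 d3 d2.
have all n : short m n = short m' n /\ long m n = long m' n.
  have [/key //|qn] := ltnP n q.+2.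
  have [->|n2] := eqVneq n q.+2; first by lia.
  have [->|n3] := eqVneq n q.+3; first by lia.
  have [->|n4] := eqVneq n q.+4; first by lia.
  have [|/= -> _ -> _] := far' n.+1; first by lia.
  by have [|/= _ -> _ ->] := far' n.+2; first by lia.
by apply: cmonomE_ext => n; case: (all n).
Qed.

(* [mon u - mon v] is an indispensable binomial: up to sign it belongs to every
   binomial generating set. The conditions at [1, 2] fix sign and shift. *)
Record indispensable (u v : cmonom E) : Prop := Indispensable {
  indispensable_vdeg : vdeg u = vdeg v;
  indispensable_u1 : short u 1 = 1%N;
  indispensable_v1 : short v 1 = 0%N;
  indispensable_short : forall i, short u i = 0%N \/ short v i = 0%N;
  indispensable_long : forall i, long u i = 0%N \/ long v i = 0%N;
  indispensable_fibre : forall m, vdeg m = vdeg u -> m = u \/ m = v }.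

Lemma pospart_balance z : (pospart z)%:Z - (pospart (- z))%:Z = z.
Proof.
have [[? ->]|[? ?]] := pospartP z; have [[? ->]|[? ?]] := pospartP (- z); lia.
Qed.

Lemma indispensable_gs s : digits s -> indispensable (gs_pos s) (gs_neg s).
Proof.
move=> /walk_wN[q [c Ww]]; have q3 := walk_q Ww.
have su := short_wmon_walk Ww (f := id) erefl.
have lu := long_wmon_walk Ww (f := id) erefl.
have sv := short_wmon_walk Ww (f := -%R) (oppr0 _).
have lv := long_wmon_walk Ww (f := -%R) (oppr0 _).
rewrite -/(gs_pos s) -/(gs_neg s) in su lu sv lv.
have uv : vdeg (gs_pos s) = vdeg (gs_neg s).
  apply/eqP/cmP => n; rewrite !vdegE !su !lu !sv !lv.
  have := walk_balanced Ww n.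
  rewrite -[in X in X -> _](pospart_balance ((wN s).1 n n.+1)).
  rewrite -[in X in X -> _](pospart_balance ((wN s).1 n n.+2)).
  rewrite -[in X in X -> _](pospart_balance ((wN s).1 n.-1 n.-1.+1)).
  rewrite -[in X in X -> _](pospart_balance ((wN s).1 n.-2 n.-2.+2)).
  by lia.
have u1 : short (gs_pos s) 1 = 1%N by rewrite su (walk_short1 Ww).
have v1 : short (gs_neg s) 1 = 0%N by rewrite sv (walk_short1 Ww).
have pos_neg z : pospart z = 0%N \/ pospart (- z) = 0%N.
  by case: z => [[|n]|n]; [left|right|left].
split=> // [i|i|m mu]; rewrite ?su ?sv ?lu ?lv //.
have posdegE n : vdeg m n = posdeg (wN s).1 n by rewrite mu vdegE !su !lu.
have unique x : vdeg x = vdeg m -> short m 1 = short x 1 -> m = x.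
  move=> xm; apply: (@tight_fibre_unique q) => // n; rewrite !posdegE.
    exact: (walk_tight Ww).
  move=> qn; apply: posdeg_eq0;
    rewrite ?(walk_short Ww) ?(walk_long Ww); try lia; do !case: ifP; lia.
(* Vertex 1 has degree 1, so the exponent of [1,2] is 0 or 1 and selects one of the two
   monomials. *)
have := congr1 (fun x : cmonom nat => x 1%N) mu.
rewrite /= !vdegE u1 lu (walk_long1 Ww) -[pospart _]/0%N /= !short0 !long0 => m1.
have [m10|m11] : short m 1 = 0%N \/ short m 1 = 1%N by lia.
  by right; apply: unique; rewrite ?mu ?v1.
by left; apply: unique; rewrite ?mu ?u1.
Qed.

Definition g2_pos : cmonom E := mmul (xm 1 2) (xm 3 4).
Definition g2_neg : cmonom E := mmul (xm 1 3) (xm 2 4).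

Lemma g2_binomial (K : fieldType) : g2 K = mon K g2_pos - mon K g2_neg.
Proof. by rewrite /g2 !xv_monom // !monM. Qed.

(** The fibre consists of the perfect matchings of {1,2,3,4}; as [1,4] is not in [E], there are only
    two. *)
Lemma indispensable_g2 : indispensable g2_pos g2_neg.
Proof.
have su i : short g2_pos i = ((1 == i) + (3 == i))%N by rewrite shortM !xm_simpl.
have lu i : long g2_pos i = 0%N by rewrite longM !xm_simpl.
have sv i : short g2_neg i = 0%N by rewrite shortM !xm_simpl.
have lv i : long g2_neg i = ((1 == i) + (2 == i))%N by rewrite longM !xm_simpl.
have uv : vdeg g2_pos = vdeg g2_neg.
  by apply/eqP/cmP => -[|[|[|[|[|[|n]]]]]]; rewrite !vdegE !su !lu !sv !lv.
split=> // [i|i|m mu]; [by right|by left|].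
have dg n : vdeg m n = vdeg g2_pos n by rewrite mu.
have far n : (4 < n)%N -> short m n.-1 = 0%N /\ long m n.-2 = 0%N.
  by move=> n4; have := dg n; rewrite !vdegE !su !lu; lia.
have [/= s4 l3] := far 5%N isT; have [/= s5 l4] := far 6%N isT.
have := dg 1%N; have := dg 2%N; have := dg 3%N; have := dg 4%N.
rewrite !vdegE !su !lu /= !short0 !long0 s4 l4 => d4 d3 d2 d1.
have beyond n : (4 < n)%N -> short m n = 0%N /\ long m n = 0%N.
  by move=> n4; have := far n.+1; have := far n.+2; rewrite /=; lia.
have [m1|m1] : short m 1 = 1%N \/ short m 1 = 0%N by lia.
  left; apply: cmonomE_ext => -[|[|[|[|[|n]]]]];
    rewrite ?short0 ?long0 ?su ?lu //=; try lia.
    by have [->] := beyond n.+4.+1 isT.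
  by have [_ ->] := beyond n.+4.+1 isT.
right; apply: cmonomE_ext => -[|[|[|[|[|n]]]]];
  rewrite ?short0 ?long0 ?sv ?lv //=; try lia.
  by have [->] := beyond n.+4.+1 isT.
by have [_ ->] := beyond n.+4.+1 isT.
Qed.

(** * Generation of the ideal and minimality *)

Section Generators.
Context (K : fieldType).

Lemma Gset_indispensable (g : RR K) :
  Gset g -> exists u v, g = mon K u - mon K v /\ indispensable u v.
Proof.
case=> [->|[s [ds ->]]].
  by exists g2_pos, g2_neg; split; [exact: g2_binomial|exact: indispensable_g2].
by exists (gs_pos s), (gs_neg s); split; [exact: gs_binomial|exact: indispensable_gs].
Qed.

Lemma ideal_gen_Gset_sub (f : RR K) : ideal_gen (shifts (@Gset K)) f -> phi f = 0.
Proof.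
move=> [l [Gl ->]]; rewrite (raddf_sum (@phi K)) big_seq big1 // => p /Gl.
move=> [g [k [/Gset_indispensable[u [v [-> uv]]] ->]]] /=.
by rewrite sh_binomial; apply/phi_mul_binomial/vdeg_shm_eq/indispensable_vdeg.
Qed.

Lemma fibre_mcong (u v : cmonom E) :
  vdeg u = vdeg v -> mcong (shifts (@Gset K)) u v.
Proof.
have gen k a b g : Gset g -> g = mon K a - mon K b ->
    mcong (shifts (@Gset K)) (shm k a) (shm k b).
  by move=> Gg eg; apply: ideal_gen_mem; exists g, k; rewrite eg sh_binomial -eg.
apply: fibre_connected.
- exact: mcong_refl.
- exact: mcong_sym.
- exact: mcong_trans.
- exact: mcongM.
- by move=> a b /ideal_gen_Gset_sub/phi_binomial.
- move=> i i0; have := gen i.-1 _ _ _ (or_introl erefl) (g2_binomial K).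
  have -> : shm i.-1 g2_pos = mmul (xm i i.+1) (xm i.+2 i.+3).
    by apply: cmonomE_ext => j;
      rewrite ?short_shm ?long_shm ?shortM ?longM !xm_simpl //; lia.
  have -> // : shm i.-1 g2_neg = mmul (xm i i.+2) (xm i.+1 i.+3).
    by apply: cmonomE_ext => j;
      rewrite ?short_shm ?long_shm ?shortM ?longM !xm_simpl //; lia.
by move=> s k ds; apply: (gen k _ _ _ _ (gs_binomial K s)); right; exists s.
Qed.

(* If [x] times a shift of [a] or [b] is [u], then the fibre of [u] forces the
   shifted binomial to be [u - v] up to sign, hence equal to [u - v]. *)
Lemma indispensable_shift u v a b k x :
  indispensable u v -> indispensable a b ->
  mmul x (shm k a) = u \/ mmul x (shm k b) = u -> a = u /\ b = v.
Proof.
move=> uv ab xu; have [u1 v1] := (indispensable_u1 uv, indispensable_v1 uv).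
have [a1 b1] := (indispensable_u1 ab, indispensable_v1 ab).
have shab : vdeg (shm k a) = vdeg (shm k b).
  exact/vdeg_shm_eq/indispensable_vdeg.
(* [u] and [v] have no common edge, so a common factor [x] is trivial. *)
have divides_both y z : mmul x y = u -> mmul x z = v -> y = u /\ z = v.
  move=> yu zv; have x1 : x = mone.
    apply: cmonomE_ext => i.
      have := indispensable_short uv i.
      by rewrite -yu -zv !shortM /short /emult; case: insub => [e|]; rewrite ?cm1; lia.
    have := indispensable_long uv i.
    by rewrite -yu -zv !longM /long /emult; case: insub => [e|]; rewrite ?cm1; lia.
  by rewrite -yu -zv x1 !mul1m.
have shm_neq : shm k a <> shm k b.
  move=> /(congr1 (fun m => short m k.+1)).
  by rewrite !short_shm subSn // subnn a1 b1.
have mulmI (y z : cmonom E) : mmul x y = mmul x z -> y = z.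
  by move=> /eqP/cmP yz; apply/eqP/cmP => e; have := yz e; rewrite !cmM; lia.
have k0 y : shm k y = u -> k = 0%N.
  move=> yu; move: u1; rewrite -yu short_shm; case: k {yu shab shm_neq xu} => // k.
  by rewrite short0.
case: xu => xu.
  have [] := indispensable_fibre uv (m := mmul x (shm k b)).
  - by rewrite -xu !vdegM shab.
  - by rewrite -xu => /mulmI/esym.
  move=> xv; have [au bv] := divides_both _ _ xu xv.
  by move: au bv (k0 _ au) => + + k00; rewrite k00 !shm0.
(* The opposite sign fails at [1,2], which lies in [a] but not in [v]. *)
have [] := indispensable_fibre uv (m := mmul x (shm k a)).
- by rewrite -xu !vdegM shab.
- by rewrite -xu => /mulmI.
move=> xv; have [bu av] := divides_both _ _ xu xv.
by move: a1 v1; rewrite -av (k0 _ bu) shm0 => ->.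
Qed.

(** The coefficient of [u] is 1 in [g]. A multiple of a shifted [h] contributes to it only if a
    monomial of that shift divides [u], which forces [h] to be [g]. *)
Lemma Gset_minimal (H : RR K -> Prop) g : (forall h, H h -> Gset h) ->
  Gset g -> ~ H g -> ~ ideal_gen (shifts H) g.
Proof.
move=> HG Gg nHg [l [Hl gl]].
have [u [v [eg uv]]] := Gset_indispensable Gg.
have uDv : u <> v.
  by move=> e; have := indispensable_u1 uv; rewrite e (indispensable_v1 uv).
have /eqP[] : (1 : K) != 0 by apply: oner_neq0.
transitivity (g@_u).
  by rewrite eg mcoeffB !mcoeff_mterm eqxx; case: eqP => [/esym//|_]; rewrite subr0.
rewrite gl raddf_sum /= big_seq big1 // => p /Hl[h [k [Hh ->]]].
have [a [b [eh ab]]] := Gset_indispensable (HG _ Hh).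
have no_shift x : ~ (mmul x (shm k a) = u \/ mmul x (shm k b) = u).
  by move=> /(indispensable_shift uv ab)[au bv]; apply: nHg; rewrite eg -au -bv -eh.
by rewrite eh sh_binomial; apply: mcoeff_mul_binomial_eq0 => x xu;
  apply: (no_shift x); [left|right].
Qed.

End Generators.

Theorem theorem6p8 (K : fieldType) :
  (forall f : RR K, inI f <-> ideal_gen (shifts (@Gset K)) f) /\
  (forall H : RR K -> Prop,
     (forall g, H g -> Gset g) -> (exists g, Gset g /\ ~ H g) ->
     ~ (forall f : RR K, inI f <-> ideal_gen (shifts H) f)).
Proof.
have IG f : inI f <-> ideal_gen (shifts (@Gset K)) f.
  by split=> [|/ideal_gen_Gset_sub //]; apply/toric_ideal_sub/fibre_mcong.
split=> // H HG [g [Gg nHg]] IH; apply: (Gset_minimal HG Gg nHg).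
apply/IH/IG/ideal_gen_mem; exists g, 0%N; split=> //.
have [u [v [-> _]]] := Gset_indispensable Gg.
by rewrite sh_binomial !shm0.
Qed.
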